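(* Let $N\in\mathbb{N}$, let $w_0,\dotsc,w_{N-1}\ge 0$, and consider the Circulant Laplacian Dynamics (CLD) protocol $$\dot z_i=-z_i+\sum_{j=0}^{N-1}w_j z_{i+j},\qquad i=0,\dotsc,N-1,\quad z_i(t)\in\mathbb{R}^2,$$ with robot indices counted modulo $N$, i.e. with circulant weight matrix $W=\operatorname{circ}(w_0,\dotsc,w_{N-1})\in\mathbb{R}^{N\times N}$. Assume the protocol is gathering. Let $E$ be the edge set of its interaction graph and let $\mathcal{C}>0$. Let $z_0(0),\dotsc,z_{N-1}(0)\in\mathbb{R}^2$ be an initial configuration with $$\|z_i(0)-z_j(0)\|\le \mathcal{C}\quad\text{for all }(j,i)\in E.$$ Then the corresponding solution satisfies $$\|z_i(t)-z_j(t)\|\le\mathcal{C}\quad\text{for all }t\ge 0\text{ and all }(j,i)\in E.$$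
   Context: $N$ robots with labels $0,\dotsc,N-1$ move in the plane; $z_i(t)=(x_i(t),y_i(t))\in\mathbb{R}^2$ is the position of robot $i$ at time $t$, and $\|\cdot\|$ is the Euclidean norm. The circulant matrix $W=\operatorname{circ}(w_0,\dotsc,w_{N-1})$ has entries $W_{i,j}=w_{(j-i)\bmod N}$, $i,j\in\{0,\dotsc,N-1\}$. All weights are non-negative (standing assumption). The interaction graph has vertices $\{0,\dotsc,N-1\}$ and edge set $E=\{(j,i): W_{i,j}\neq 0\}$; an edge $(j,i)$ means that robot $i$ uses the position of robot $j$. $\mathcal{C}$ is the constant viewing range; it does not enter the differential equations, i.e. solutions are those of the stated system without any visibility cut-off. The protocol is called gathering if, for every initial configuration, the solution converges as $t\to\infty$ to a gathering point, i.e. there is $z^*\in\mathbb{R}^2$ with $z_i(t)\to z^*$ for all $i$, and if the system is in equilibrium in every gathering point, i.e. $\dot z_i=0$ for all $i$ whenever $z_0=\dotsb=z_{N-1}$. *)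

(* Defs.v *)
From HB Require Import structures.
From mathcomp Require Import all_boot all_order all_algebra.
From mathcomp Require Import all_classical all_reals all_analysis.

Set Implicit Arguments.
Unset Strict Implicit.
Unset Printing Implicit Defensive.

Import Order.TTheory GRing.Theory Num.Theory.
Import numFieldNormedType.Exports.

Local Open Scope classical_set_scope.
Local Open Scope ring_scope.

(* The number of robots is N = n.+1.  Labels live in 'I_n.+1, whose canonical *)
(* zmodType structure makes + and - on labels the operations modulo N.        *)
Definition config (R : realType) (n : nat) : Type := 'I_n.+1 -> 'rV[R]_2.

(* Needed because the library norm `|u| on 'rV_2 is the sup norm. *)
Definition enorm (R : realType) (u : 'rV[R]_2) : R :=
  Num.sqrt (\sum_(k < 2) u 0 k ^+ 2).

Definition circ (R : realType) (n : nat) (w : 'I_n.+1 -> R) : 'M[R]_n.+1 :=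
  \matrix_(i, j) w (j - i).

(* (j, i) is an edge when robot i uses the position of robot j. *)
Definition edges (R : realType) (n : nat) (W : 'M[R]_n.+1) :
    {set 'I_n.+1 * 'I_n.+1} :=
  [set e | W e.2 e.1 != 0]%SET.

Definition cld (R : realType) (n : nat) (w : 'I_n.+1 -> R)
    (z : config R n) : config R n :=
  fun i => - z i + \sum_(j < n.+1) w j *: z (i + j).

(* Forward solution of z' = f z, z 0 = z0.  The values z t for t < 0 are      *)
(* irrelevant; at t = 0 only continuity from the right is required, from      *)
(* which, for continuous f, the one-sided derivative at 0 follows.            *)
Definition solution (R : realType) (n : nat) (f : config R n -> config R n)
    (z0 : config R n) (z : R -> config R n) : Prop :=
  [/\ z 0 = z0,
      forall i, {within `[0, +oo[, continuous (fun t : R => z t i)} &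
      forall (t : R) i, 0 < t ->
        is_derive t (1 : R) (fun s : R => z s i) (f (z t) i)].

(* "The solution" is rendered by quantifying over all solutions: for the      *)
(* linear field cld w there is exactly one on [0, +oo) for each z0.           *)
Definition gathering (R : realType) (n : nat)
    (f : config R n -> config R n) : Prop :=
  (forall (z0 : config R n) (z : R -> config R n), solution f z0 z ->
     exists zstar : 'rV[R]_2,
       forall i, z t i @[t --> +oo] --> zstar) /\
  (forall z : config R n, (forall i j, z i = z j) -> forall i, f z i = 0).

(* Main.v *)
(* Equilibrium at gathering points forces the weights to sum to 1.  For a     *)
(* fixed offset k with w_k <> 0, W being circulant, the differences           *)
(* d_l = z_l - z_(l+k) satisfy the same system d' = cld w d, and every pair   *)
(* (l + k, l) is an edge.  Hence each scalar projection <u, d_l> moves        *)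
(* towards a convex combination of the others, and by a maximum principle it  *)
(* stays below the initial bound |u| C; choosing u = d_i(t) for the time t in *)
(* question gives |d_i(t)|^2 <= |d_i(t)| C.                                   *)

Require Import Defs.
From HB Require Import structures.
From mathcomp Require Import all_boot all_order all_algebra.
From mathcomp Require Import all_classical all_reals all_analysis.
From mathcomp Require Import ring lra.

Set Implicit Arguments.
Unset Strict Implicit.
Unset Printing Implicit Defensive.

Import Order.TTheory GRing.Theory Num.Theory.
Import numFieldNormedType.Exports.

Local Open Scope ring_scope.

(** The comparison is scalar: [maximum_principle] handles a finite family in which whichever
    function is largest at a given positive time has nonpositive derivative then. The lemma
    [cldB_shift] makes the differences a solution, and [gathering_sum_weights] gives the projections
    that sign condition. *)

(** Left difference quotients at [c] are quotients of nonpositive numbers. One side suffices, so the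
    lemma applies when [c] is the right end of a time interval. *)
Lemma derive_ge0_at_left_max (R : realType) (f : R -> R) (a c df : R) :
  a < c -> (forall t, t \in `[a, c] -> f t <= f c) ->
  is_derive c (1 : R) f df -> 0 <= df.
Proof.
move=> ac fmax [fc <-]; rewrite ['D_1 f c]cvg_at_leftE; last exact: fc.
apply: limr_ge.
  rewrite -(cvg_at_leftE (fun h => h^-1 *: ((f \o shift c) _ - f c))) //.
  apply: cvg_trans fc; apply: cvg_app.
  move=> A [e e0 Ae]; exists e => // x xe x0.
  by apply: Ae => //; exact/ltr0_neq0.
near=> h.
have h0 : h < 0 by near: h; exists 1 => /=.
apply: mulr_le0; first by rewrite invr_le0 ltW.
rewrite subr_le0 [_%:A]mulr1; apply: fmax.
have hac : `|h| < c - a.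
  near: h; exists (c - a) => /=; first by rewrite subr_gt0.
  by move=> h; rewrite /= distrC subr0.
move: hac; rewrite ltr0_norm // in_itv /= => hac; lra.
Unshelve. all: by end_near. Qed.

Lemma maximum_principle (R : realType) (I : finType) (x dx : I -> R -> R)
    (M : R) :
  (forall i, {within `[0, +oo[, continuous (x i)}%classic) ->
  (forall i (t : R), 0 < t -> is_derive t (1 : R) (x i) (dx i t)) ->
  (forall i (t : R), 0 < t -> (forall j, x j t <= x i t) -> dx i t <= 0) ->
  (forall i, x i 0 <= M) ->
  forall i (t : R), 0 <= t -> x i t <= M.
Proof.
move=> xc xd dx_le0 x0 i0 T T0; rewrite -subr_le0 leNgt; apply/negP => MT.
have T1 : 0 < T + 1 by lra.
(* Dividing by [T + 1] rather than [T] covers [T = 0]. *)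
have [e e0 eT] : exists2 e, 0 < e & e * T < x i0 T - M.
  exists ((x i0 T - M) / (T + 1)); first exact: divr_gt0.
  rewrite mulrAC ltr_pdivrMr //; nra.
(* The tilt by [e * t] makes the derivative strictly negative at a maximum    *)
(* over all i and [0, T] reached at a positive time, so it is reached at 0.   *)
pose g i t := x i t - e * t.
have gmax i : {c | c \in `[0, T] & forall t, t \in `[0, T] -> g i t <= g i c}.
  apply: cid2; apply: EVT_max => //.
  have xcT : {within `[0, T], continuous (x i)}%classic.
    apply: continuous_subspaceW (xc i) => t /=.
    by rewrite !in_itv /= => /andP[->].
  move=> t; apply: continuousB; first exact: xcT.
  by apply: continuous_subspaceT => r; exact: mulrl_continuous.
pose c i := s2val (gmax i).
have cT i : c i \in `[0, T] := s2valP (gmax i).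
have cmax i := s2valP' (gmax i).
pose k := [arg max_(i > i0) g i (c i)]%O.
have kmax i t : t \in `[0, T] -> g i t <= g k (c k).
  move=> /cmax /le_trans; apply.
  by rewrite /k; case: arg_maxP => // j _; apply.
have := cT k; rewrite in_itv /= le_eqVlt => /andP[/orP[/eqP c0|c_gt0] cleT].
  have := kmax i0 T; rewrite in_itv /= T0 lexx => /(_ isT).
  by rewrite /g -c0; have := x0 k; lra.
have : 0 <= dx k (c k) - e.
  apply: (@derive_ge0_at_left_max _ (g k) 0 (c k)) => //.
    move=> t; rewrite in_itv /= => /andP[t0 tc]; apply: kmax.
    by rewrite in_itv /= t0 (le_trans tc).
  have dxk := xd k _ c_gt0.
  have := is_deriveB dxk (is_deriveZ e (is_derive_id (c k) (1 : R))).
  by rewrite [_ *: _]mulr1.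
suff : dx k (c k) <= 0 by lra.
(* At a common time the tilt is the same for all indices, so it cancels. *)
by apply: dx_le0 => // j; have := kmax j _ (cT k); rewrite /g lerD2r.
Qed.

Definition dot (R : realType) (m : nat) (u v : 'rV[R]_m) : R :=
  \sum_(k < m) u 0 k * v 0 k.

Lemma dot_is_linear (R : realType) m (u : 'rV[R]_m) : scalar (dot u).
Proof.
move=> a v w; rewrite /dot mulr_sumr -big_split; apply: eq_bigr => k _ /=.
by rewrite !mxE; ring.
Qed.

HB.instance Definition _ (R : realType) m (u : 'rV[R]_m) :=
  GRing.isLinear.Build R 'rV[R]_m R *%R (dot u) (@dot_is_linear R m u).

Lemma dot_continuous (R : realType) m (u : 'rV[R]_m) : continuous (dot u).
Proof.
move=> v; apply: (cvg_big add_continuous (nbhs_filter v)) => k _.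
apply: (@continuousM _ _ (cst (u 0 k))); first exact: cst_continuous.
exact: coord_continuous.
Qed.

Lemma is_derive_dot (R : realType) m (u : 'rV[R]_m) (f : R -> 'rV[R]_m)
    (t : R) df :
  is_derive t (1 : R) f df -> is_derive t (1 : R) (dot u \o f) (dot u df).
Proof.
move=> [fd <-]; rewrite derive_mx//.
have fkd k : is_derive t (1 : R) (fun s => f s 0 k) ('D_1 (fun s => f s 0 k) t).
  apply: derivableP; exact: (derivable_mxP f t 1).1 fd _ _.
have := is_derive_sum (fun k => is_deriveZ (u 0 k) (fkd k)).
rewrite fct_sumE /dot => /is_derive_eq; apply.
by apply: eq_bigr => k _; rewrite mxE.
Qed.

Lemma enorm_ge0 (R : realType) (u : 'rV[R]_2) : 0 <= enorm u.
Proof. exact: sqrtr_ge0. Qed.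

Lemma dot_enorm (R : realType) (u : 'rV[R]_2) : dot u u = enorm u ^+ 2.
Proof.
rewrite sqr_sqrtr; last by apply: sumr_ge0 => k _; exact: sqr_ge0.
by apply: eq_bigr => k _; rewrite expr2.
Qed.

Lemma dot_le_enorm (R : realType) (u v : 'rV[R]_2) :
  dot u v <= enorm u * enorm v.
Proof.
rewrite -[leRHS]ger0_norm ?mulr_ge0 ?enorm_ge0//.
apply: le_trans (ler_norm _) _; rewrite -ler_sqr ?nnegrE //.
rewrite !real_normK ?num_real // exprMn -!dot_enorm.
rewrite /dot !big_ord_recl !big_ord0 !addr0.
set a := u _ _; set b := u _ _; set c := v _ _; set d := v _ _.
(* Lagrange's identity in the plane. *)
have := sqr_ge0 (a * d - b * c); nra.
Qed.

Lemma gathering_sum_weights (R : realType) n (w : 'I_n.+1 -> R) :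
  gathering (cld w) -> \sum_j w j = 1.
Proof.
move=> [_ /(_ (fun=> const_mx 1) (fun _ _ => erefl) 0)].
move=> /rowP /(_ 0); rewrite /cld -scaler_suml !mxE mulr1 addrC.
by move=> /eqP; rewrite subr_eq0 => /eqP.
Qed.

(** The field is linear and commutes with cyclic relabelling. *)
Lemma cldB_shift (R : realType) n (w : 'I_n.+1 -> R) (z : config R n) i k :
  cld w z i - cld w z (i + k) = cld w (fun l => z l - z (l + k)) i.
Proof.
rewrite /cld opprD addrACA -opprD -sumrB; congr (_ + _).
apply: eq_bigr => j _.
by rewrite -scalerBr addrAC.
Qed.

Theorem theorem4p3 (R : realType) (n : nat) (w : 'I_n.+1 -> R)
    (w_ge0 : forall j, 0 <= w j)
    (w_gathering : gathering (cld w))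
    (C : R) (C_gt0 : 0 < C)
    (z0 : config R n)
    (z0_visible : forall i j : 'I_n.+1, (j, i) \in edges (circ w) ->
       enorm (z0 i - z0 j) <= C)
    (z : R -> config R n) (z_sol : solution (cld w) z0 z) :
  forall (t : R) (i j : 'I_n.+1), 0 <= t -> (j, i) \in edges (circ w) ->
    enorm (z t i - z t j) <= C.
Proof.
move=> t i j t0; rewrite inE mxE /= => wk.
case: z_sol => zz0 zc zd.
pose k := j - i; pose d s l := z s l - z s (l + k).
have -> : z t i - z t j = d t i by rewrite /d /k [i + _]addrC subrK.
set u := d t i; pose x l := dot u \o d ^~ l.
have xc l : {within `[0, +oo[, continuous (x l)}%classic.
  have dc : {within `[0, +oo[, continuous (d ^~ l)}%classic.
    by move=> s; apply: continuousB; exact: zc.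
  move=> s; exact: (cvg_comp _ _ (dc s) (@dot_continuous _ _ u (d s l))).
have xd l (s : R) : 0 < s -> is_derive s (1 : R) (x l) (dot u (cld w (d s) l)).
  move=> s0; apply: is_derive_dot; rewrite -cldB_shift.
  exact: is_deriveB (zd s l s0) (zd s (l + k) s0).
have dx_le0 l (s : R) : 0 < s -> (forall m, x m s <= x l s) ->
    dot u (cld w (d s) l) <= 0.
  move=> _ xmax; rewrite /cld linearD linearN addrC subr_le0 linear_sum.
  (* Writing [1] as the sum of the weights allows a termwise comparison with the maximal
     projection. *)
  rewrite -[leRHS]mul1r -(gathering_sum_weights w_gathering) mulr_suml.
  by apply: ler_sum => m _; rewrite linearZ ler_wpM2l //; exact: xmax.
have x0 l : x l 0 <= enorm u * C.
  apply: le_trans (dot_le_enorm _ _) _; rewrite ler_wpM2l ?enorm_ge0//.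
  by rewrite /d zz0; apply: z0_visible; rewrite inE mxE /= [l + k]addrC addrK.
have := maximum_principle xc xd dx_le0 x0 i t0.
rewrite /x /= -/u dot_enorm expr2.
(* The factor [enorm u] cancels unless it is zero, and then [0 < C] suffices. *)
have := enorm_ge0 u; rewrite le_eqVlt => /orP[/eqP <- _|u0]; first exact: ltW.
by rewrite ler_pM2l.
Qed.
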